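(* Let $T\subset\mathbb{R}^d$ be compact (with positive Lebesgue measure) and let $C:T\times T\to\mathbb{R}$ be a symmetric positive semidefinite kernel that is $\alpha$-Hölder continuous in each coordinate: there exist $M_C>0$ and $\alpha\in(0,1]$ with $|C(t_1,s)-C(t_2,s)|\le M_C|t_1-t_2|^{\alpha}$ for all $t_1,t_2,s\in T$. Let $\{(\lambda_j,\phi_j)\}$ be the eigenpairs of the integral operator of $C$ on $L^2(T)$ (so $C(s,t)=\sum_j\lambda_j\phi_j(s)\phi_j(t)$ with continuous $\phi_j$), and let $Z(t)=\sum_j\sqrt{\lambda_j}Z_j\phi_j(t)$, $t\in T$ (series converging in $L^2(\Omega)$ for each $t$), with $Z_j$ i.i.d. Laplace of mean $0$ and variance $1$; this is an ICLP with covariance function $C$. Then there exists a process $\tilde Z:T\times\Omega\to\mathbb{R}$ such that (1) for every $\omega\in\Omega$, $t\mapsto\tilde Z_\omega(t)$ is continuous on $T$, and (2) for every $t\in T$, $P(\tilde Z(t)=Z(t))=1$.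
   Context: The Laplace distribution with mean 0 and variance 1 has density $\frac1{\sqrt2}e^{-\sqrt2|x|}$. *)

(* Defs.v *)
From HB Require Import structures.
From mathcomp Require Import all_boot all_order all_algebra.
From mathcomp Require Import all_classical all_reals all_analysis.
Set Implicit Arguments. Unset Strict Implicit. Unset Printing Implicit Defensive.
Import Order.TTheory GRing.Theory Num.Theory.
Import numFieldNormedType.Exports.
Local Open Scope classical_set_scope.
Local Open Scope ring_scope.

(* R^d is represented by row vectors 'rV[R]_d (its topology is the usual one).
   [Rd R d] is the same carrier equipped with the Borel sigma-algebra, i.e.
   the sigma-algebra generated by the open sets of 'rV[R]_d. *)
Definition Rd (R : realType) (d : nat) := g_sigma_algebraType (@open 'rV[R]_d).

Definition eucl_norm (R : realType) (d : nat) (v : 'rV[R]_d) : R :=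
  Num.sqrt (\sum_(i < d) v ord0 i ^+ 2).

(* mu is the Lebesgue measure on (the Borel sets of) R^d: it gives every
   half-open box its volume.  (This characterizes the measure uniquely on
   Borel sets.) *)
Definition is_lebesgue_measure (R : realType) (d : nat)
    (mu : set (Rd R d) -> \bar R) : Prop :=
  forall a b : 'rV[R]_d, (forall i, a ord0 i <= b ord0 i) ->
    mu [set x : Rd R d | forall i, a ord0 i <= (x : 'rV[R]_d) ord0 i < b ord0 i]
    = (\prod_(i < d) (b ord0 i - a ord0 i))%:E.

Definition symmetric_kernel (R : realType) (d : nat) (T : set 'rV[R]_d)
    (C : 'rV[R]_d -> 'rV[R]_d -> R) : Prop :=
  forall s t, T s -> T t -> C s t = C t s.

Definition psd_kernel (R : realType) (d : nat) (T : set 'rV[R]_d)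
    (C : 'rV[R]_d -> 'rV[R]_d -> R) : Prop :=
  forall (n : nat) (x : 'I_n -> 'rV[R]_d) (c : 'I_n -> R),
    (forall i, T (x i)) ->
    0 <= \sum_(i < n) \sum_(j < n) c i * c j * C (x i) (x j).

(* Laplace density with mean 0 and variance 1. *)
Definition laplace_pdf (R : realType) (x : R) : R :=
  (Num.sqrt 2)^-1 * expR (- (Num.sqrt 2 * `|x|)).

Definition laplace_distributed (R : realType) (dO : measure_display)
    (Omega : measurableType dO) (P : probability Omega R) (X : Omega -> R) : Prop :=
  measurable_fun setT X /\
  forall A : set R, measurable A ->
    P (X @^-1` A) = (\int[lebesgue_measure]_(x in A) (laplace_pdf x)%:E)%E.

Definition mutually_independent (R : realType) (dO : measure_display)
    (Omega : measurableType dO) (P : probability Omega R)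
    (X : nat -> Omega -> R) : Prop :=
  forall (J : seq nat) (A : nat -> set R), uniq J ->
    (forall j, measurable (A j)) ->
    P (\bigcap_(j in [set j | j \in J]) (X j @^-1` A j))
    = (\prod_(j <- J) P (X j @^-1` A j))%E.

(* Main.v *)
(* The increments of the process have exponential tails: for a Laplace variable
   X and |b| <= 1 one has E exp(bX) = 2 / (2 - b^2) <= exp(b^2), so by
   independence and Markov's inequality a sum of [a_j Z_j] with
   [sum a_j^2 <= sigma^2] exceeds [x sigma] in absolute value with probability
   at most 2 exp(1 - x), and such bounds survive L^2 limits.  For
   [Z s - Z t] the sum of squares is
   [sum lambda_j (phi_j s - phi_j t)^2 <= C s s - C s t - C t s + C t t], which
   the Hoelder condition bounds by [2 MC |s - t|^alpha]; here one needs
   [lambda_j >= 0], a consequence of positive semidefiniteness of C.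
   Approximating each point t of T by a point [proj_k t] of T in the same cube of
   mesh 2^-k, of which there are O(2^(kd)), the exponential tails beat the number
   of pairs of such points, so by Borel-Cantelli t |-> Z (proj_k t) converges
   almost surely uniformly on T, to a continuous function, with geometric speed.
   The limit is the continuous modification. *)

Require Import Defs.
From HB Require Import structures.
From mathcomp Require Import all_boot all_order all_algebra.
From mathcomp Require Import all_classical all_reals all_analysis.
From mathcomp Require Import measurable_realfun ring lra.
Set Implicit Arguments. Unset Strict Implicit. Unset Printing Implicit Defensive.
Import Order.TTheory GRing.Theory Num.Theory.
Import numFieldNormedType.Exports HBNNSimple.
Local Open Scope classical_set_scope.
Local Open Scope ring_scope.

(** * Exponential moments of independent Laplace variables *)

(** Both sides integrate g against the image under [X1], [X2] of a weighted measure. Agreement on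
    indicators passes to simple functions by linearity and to g by monotone convergence. The weights
    let this serve both for the passage to a density and for independence. *)
Lemma ge0_integral_comp_indic d1 d2 (T1 : measurableType d1)
    (T2 : measurableType d2) (R : realType)
    (m1 : {measure set T1 -> \bar R}) (m2 : {measure set T2 -> \bar R})
    (X1 : T1 -> R) (X2 : T2 -> R) (W1 : T1 -> R) (W2 : T2 -> R) :
  measurable_fun setT X1 -> measurable_fun setT X2 ->
  measurable_fun setT W1 -> measurable_fun setT W2 ->
  (forall x, 0 <= W1 x) -> (forall x, 0 <= W2 x) ->
  (forall A : set R, measurable A ->
    (\int[m1]_x (W1 x * \1_A (X1 x))%:E = \int[m2]_x (W2 x * \1_A (X2 x))%:E)%E) ->
  forall g : R -> R, measurable_fun setT g -> (forall x, 0 <= g x) ->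
  (\int[m1]_x (W1 x * g (X1 x))%:E = \int[m2]_x (W2 x * g (X2 x))%:E)%E.
Proof.
move=> mX1 mX2 mW1 mW2 W1_ge0 W2_ge0 H g mg g0.
have mEg : measurable_fun setT (EFin \o g) by exact/measurable_EFinP.
pose h := nnsfun_approx measurableT mEg.
have mh n : measurable_fun setT (h n : R -> R) by exact: measurable_funPT.
have mhA n (y : R) : measurable (h n @^-1` [set y]).
  by rewrite -[_ @^-1` _]setTI; exact: mh.
have simple d (T : measurableType d) (m : {measure set T -> \bar R}) (X W : T -> R) n :
    measurable_fun setT X -> measurable_fun setT W -> (forall x, 0 <= W x) ->
    (\int[m]_x (W x * h n (X x))%:E =
     \sum_(y \in range (h n)) (\int[m]_x (y * (W x * \1_(h n @^-1` [set y]) (X x)))%:E))%E.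
  move=> mX mW W0.
  transitivity (\int[m]_x (\sum_(y \in range (h n))
      (y * (W x * \1_(h n @^-1` [set y]) (X x)))%:E))%E.
    apply: eq_integral => x _; rewrite fsumEFin//; congr EFin.
    rewrite [in LHS](fimfunE (h n) (X x)) fsbig_finite//= [in RHS]fsbig_finite//= big_distrr/=.
    by apply: eq_bigr => y _; rewrite mulrCA.
  pose F (y : R) (x : T) : \bar R := if y \in range (h n)
    then (y * (W x * \1_(h n @^-1` [set y]) (X x)))%:E else 0%E.
  have mF y : measurable_fun setT (F y).
    rewrite /F; case: (y \in _) => //; apply/measurable_EFinP.
    apply: measurable_funM => //; apply: measurable_funM => //.
    apply: (measurableT_comp _ mX); apply: measurable_indic.
    exact: mhA.
  have F0 y x : setT x -> (0 <= F y x)%E.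
    rewrite /F; case: ifPn => // /set_mem[z _ <-] _.
    by rewrite lee_fin !mulr_ge0// fun_ge0.
  transitivity (\int[m]_x (\sum_(y \in range (h n)) F y x))%E.
    by apply: eq_integral => x _; apply: eq_fsbigr => y; rewrite /F => ->.
  rewrite (ge0_integral_fsum m measurableT mF F0 (fimfunP (h n))).
  by apply: eq_fsbigr => y; rewrite /F => ->.
have eqn n : (\int[m1]_x (W1 x * h n (X1 x))%:E = \int[m2]_x (W2 x * h n (X2 x))%:E)%E.
  rewrite !simple//; apply: eq_fsbigr => y /set_mem[z _ <-].
  have hz : 0 <= h n z by exact: fun_ge0.
  have mA : measurable (h n @^-1` [set h n z]) by exact: mhA.
  under eq_integral do rewrite EFinM.
  rewrite ge0_integralZl//; last first.
  - by move=> x _; rewrite lee_fin mulr_ge0.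
  - apply/measurable_EFinP; apply: measurable_funM => //.
    by apply: measurableT_comp => //; exact: measurable_indic.
  rewrite H//.
  under [RHS]eq_integral do rewrite EFinM.
  rewrite [RHS]ge0_integralZl//.
  - apply/measurable_EFinP; apply: measurable_funM => //.
    by apply: measurableT_comp => //; exact: measurable_indic.
  - by move=> x _; rewrite lee_fin mulr_ge0.
have lim d (T : measurableType d) (m : {measure set T -> \bar R}) (X W : T -> R) :
    measurable_fun setT X -> measurable_fun setT W -> (forall x, 0 <= W x) ->
    ((fun n => \int[m]_x (W x * h n (X x))%:E) @ \oo --> \int[m]_x (W x * g (X x))%:E)%E.
  move=> mX mW W0.
  have -> : (fun x => (W x * g (X x))%:E) =
      (fun x => limn (fun n => (W x * h n (X x))%:E)).
    apply/funext => x; apply/esym/cvg_lim => //.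
    under eq_fun do rewrite EFinM.
    rewrite EFinM; apply: cvgeZl => //.
    apply: (@cvg_nnsfun_approx _ _ _ _ measurableT _ mEg) => //.
    by move=> *; rewrite lee_fin.
  apply: cvg_monotone_convergence => //.
  - move=> n; apply/measurable_EFinP; apply: measurable_funM => //.
    exact: measurableT_comp.
  - by move=> n x _; rewrite lee_fin mulr_ge0// fun_ge0.
  - move=> x _ a b ab; rewrite lee_fin ler_wpM2l//.
    by have /(_ _ _ ab)/lefP := @nd_nnsfun_approx _ _ _ _ measurableT _ mEg.
rewrite -(cvg_lim (@ereal_hausdorff R) (lim _ _ m1 _ _ mX1 mW1 W1_ge0)).
by under eq_fun do rewrite eqn; apply/cvg_lim => //; exact: lim.
Qed.

(** Independence is the case where every factor is an indicator; the indicators are then replaced by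
    general functions one factor at a time. *)
Lemma expectation_prod_indep (R : realType) (dO : measure_display)
    (Omega : measurableType dO) (P : probability Omega R) (X : nat -> Omega -> R)
    (f : nat -> R -> R) (e : nat -> R) (n : nat) :
  (forall j, measurable_fun setT (X j)) -> mutually_independent P X ->
  (forall j, measurable_fun setT (f j)) -> (forall j x, 0 <= f j x) ->
  (forall j, (\int[P]_w (f j (X j w))%:E = (e j)%:E)%E) ->
  (\int[P]_w (\prod_(j < n) f j (X j w))%:E = (\prod_(j < n) e j)%:E)%E.
Proof.
move=> mX indX.
(* Only the first k factors are arbitrary, the others being indicators. The case k = 0 is
   independence and k = n is the goal. *)
suff claim k : forall (f : nat -> R -> R) (e : nat -> R),
    (forall j, measurable_fun setT (f j)) -> (forall j x, 0 <= f j x) ->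
    (forall j, (\int[P]_w (f j (X j w))%:E = (e j)%:E)%E) ->
    (forall j, (k <= j < n)%N -> exists2 A : set R, measurable A & f j = \1_A) ->
    (\int[P]_w (\prod_(j < n) f j (X j w))%:E = (\prod_(j < n) e j)%:E)%E.
  move=> mf f0 fe; apply: (claim n) => // j /andP[nj jn].
  by move: (leq_ltn_trans nj jn); rewrite ltnn.
elim: k => [|k IH] {}f {}e mf f0 fe find.
  have /choice[A HA] : forall j, exists A : set R,
      measurable A /\ ((j < n)%N -> f j = \1_A).
    move=> j; have [jn|nj] := ltnP j n; last by exists set0; split.
    by have [A mA fA] := find j jn; exists A.
  have mXA j : measurable (X j @^-1` A j).
    by rewrite -[_ @^-1` _]setTI; apply: mX => //; case: (HA j).
  have prodE w : \prod_(j < n) f j (X j w) =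
      \1_(\bigcap_(j in [set j | j \in iota 0 n]) (X j @^-1` A j)) w.
    rewrite indicE; case: (boolP (w \in _)) => [/set_mem H|/negP H].
      rewrite big1// => j _; rewrite (HA j).2// indicE mem_set//.
      by apply: H; rewrite /= mem_iota /= add0n.
    apply/eqP/prodf_eq0 => /=.
    have [j] : exists j, ~ ((j < n)%N -> A j (X j w)).
      apply/existsNP => H'; apply/H/mem_set => j /=; rewrite mem_iota add0n => jn.
      exact: H'.
    move=> /not_implyP[jn nA]; exists (Ordinal jn) => //=.
    by rewrite (HA j).2// indicE memNset.
  under eq_integral do rewrite prodE.
  rewrite integral_indic//; last first.
    by rewrite bigcap_mkcond; apply: bigcapT_measurable => j; case: ifP.
  rewrite setIT; transitivity (\prod_(j <- iota 0 n) P (X j @^-1` A j))%E.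
    by apply: indX; [exact: iota_uniq|move=> j; case: (HA j)].
  rewrite -[X in iota 0 X]subn0 -/(index_iota 0 n) big_mkord.
  rewrite (big_morph EFin (@EFinM R) erefl).
  apply: eq_bigr => j _; rewrite -fe.
  rewrite (HA j).2//.
  rewrite [RHS](_ : _ = \int[P]_w (\1_(X j @^-1` A j) w)%:E)%E//.
  by rewrite integral_indic ?setIT.
have [kn|nk] := ltnP k n; last first.
  apply: IH => // j /andP[kj jn].
  by move: (leq_ltn_trans (leq_trans nk kj) jn); rewrite ltnn.
pose i : 'I_n := Ordinal kn.
have e0 j : 0 <= e j by rewrite -lee_fin -fe integral_ge0// => w _; rewrite lee_fin.
pose W w := \prod_(j < n | j != i) f j (X j w).
pose c := \prod_(j < n | j != i) e j.
have mfX j : measurable_fun setT (fun w => f j (X j w)).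
  exact: measurableT_comp.
have mW : measurable_fun setT W.
  rewrite (_ : W = fun w => \prod_(j <- [seq j <- index_enum 'I_n | j != i]) f j (X j w)).
    by apply: measurable_prod => j _; exact: mfX.
  by apply/funext => w; rewrite big_filter.
transitivity (\int[P]_w (W w * f k (X k w))%:E)%E.
  by apply: eq_integral => w _; rewrite (bigD1 i)//= mulrC.
(* The other factors form the weight [W], to be exchanged for the constant c. This has to be checked
   only when the k-th factor is an indicator, which is the induction hypothesis. *)
rewrite (@ge0_integral_comp_indic _ _ _ _ _ P P (X k) (X k) W (cst c))//.
- under eq_integral do rewrite /cst EFinM.
  rewrite ge0_integralZl//; last 3 first.
  + exact/measurable_EFinP.
  + by move=> w _; rewrite lee_fin.
  + by rewrite lee_fin prodr_ge0.
  by rewrite fe -EFinM [in RHS](bigD1 i)//= mulrC.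
- by move=> w; rewrite prodr_ge0.
- by move=> w; rewrite prodr_ge0.
move=> A mA.
have mXA : measurable (X k @^-1` A) by rewrite -[_ @^-1` _]setTI; exact: mX.
have EA : (\int[P]_w (\1_A (X k w))%:E = (fine (P (X k @^-1` A)))%:E)%E.
  rewrite [LHS](_ : _ = \int[P]_w (\1_(X k @^-1` A) w)%:E)%E//.
  by rewrite integral_indic// setIT fineK// fin_num_measure.
pose f' j := if j == k then \1_A else f j.
pose e' j := if j == k then fine (P (X k @^-1` A)) else e j.
transitivity (\int[P]_w (\prod_(j < n) f' j (X j w))%:E)%E.
  apply: eq_integral => w _; rewrite [in RHS](bigD1 i)//= mulrC /f' eqxx.
  by congr ((_ * _)%:E); apply: eq_bigr => j; rewrite -val_eqE/= => /negPf ->.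
rewrite (IH f' e')//.
- under eq_integral do rewrite /cst EFinM.
  rewrite ge0_integralZl//; last 2 first.
  + apply/measurable_EFinP; apply: (measurableT_comp _ (mX k)).
    exact: measurable_indic.
  + by rewrite lee_fin prodr_ge0.
  rewrite EA -EFinM [in LHS](bigD1 i)//= mulrC /e' eqxx.
  by congr ((_ * _)%:E); apply: eq_bigr => j; rewrite -val_eqE/= => /negPf ->.
- by move=> j; rewrite /f'; case: eqP.
- by move=> j x; rewrite /f'; case: eqP.
- by move=> j; rewrite /f' /e'; case: eqP => [->|].
- move=> j /andP[kj jn]; rewrite /f'; case: eqP => [_|/eqP jk]; first by exists A.
  by apply: find; rewrite jn andbT ltn_neqAle eq_sym jk.
Qed.

(** The exponential density c exp(-c x) has total mass 1. An infinite value of the integral is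
    excluded because c times it is 1. *)
Lemma integral_expR_neg (R : realType) (c : R) : 0 < c ->
  (\int[lebesgue_measure]_(x in `[0%R, +oo[) (expR (- c * x))%:E = (c^-1)%:E)%E.
Proof.
move=> c0.
have mf : measurable_fun (`[0%R, +oo[ : set R) (fun x : R => (expR (- c * x))%:E).
  apply/measurable_EFinP; apply: (measurableT_comp (@measurable_expR R)).
  exact: mulrl_measurable.
have := integral_exponential_pdf c0.
rewrite [X in (\int[_]_x X x)%E](_ : _ =
  (fun x => (c * expR (- c * x))%:E) \_ `[0%R, +oo[); last first.
  by apply/funext => x; rewrite /exponential_pdf !patchE; case: ifP.
rewrite -integral_mkcond; under eq_integral do rewrite EFinM.
rewrite ge0_integralZl//; last by rewrite lee_fin ltW.
set I := (\int[_]_(x in _) _)%E => cI.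
have I0 : (0 <= I)%E by apply: integral_ge0 => x _; rewrite lee_fin expR_ge0.
case: I I0 cI => [r _ [cr]||]//=; last by rewrite gt0_muley ?lte_fin.
by congr EFin; rewrite -[LHS](mulKf (lt0r_neq0 c0)) cr mulr1.
Qed.

Lemma laplace_pdf_ge0 (R : realType) (x : R) : 0 <= laplace_pdf x.
Proof. by rewrite mulr_ge0 ?invr_ge0 ?sqrtr_ge0 ?expR_ge0. Qed.

Lemma measurable_laplace_pdf (R : realType) :
  measurable_fun setT (@laplace_pdf R).
Proof.
apply: measurable_funM => //.
apply: (measurableT_comp (@measurable_expR R)).
apply: (measurableT_comp (@oppr_measurable R _)).
by apply: measurable_funM.
Qed.

(** With s = sqrt 2, the density times exp(b x) is an exponential of rate s - b on the right
    half-line and, after reflection, s + b on the left. Both rates are positive as |b| <= 1 < s, and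
    s^-1 (1 / (s - b) + 1 / (s + b)) = 2 / (s^2 - b^2). *)
Lemma laplace_mgf (R : realType) (dO : measure_display)
    (Omega : measurableType dO) (P : probability Omega R) (X : Omega -> R) (b : R) :
  laplace_distributed P X -> `|b| <= 1 ->
  (\int[P]_w (expR (b * X w))%:E = (2 / (2 - b ^+ 2))%:E)%E.
Proof.
move=> [mX HX] b1.
pose s : R := Num.sqrt 2.
have s2 : s ^+ 2 = 2 by rewrite sqr_sqrtr.
have s0 : 0 < s by rewrite sqrtr_gt0.
have bs : - s < b < s by move: b1; rewrite ler_norml => /andP[]; nra.
pose g x : R := expR (b * x).
have mg : measurable_fun setT g.
  apply: (measurableT_comp (@measurable_expR R)).
  exact: mulrl_measurable.
pose F x : \bar R := (laplace_pdf x * g x)%:E.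
have mF : measurable_fun [set: R] F.
  by apply/measurable_EFinP; apply: measurable_funM => //; exact: measurable_laplace_pdf.
have F0 x : (0 <= F x)%E by rewrite lee_fin mulr_ge0 ?laplace_pdf_ge0 ?expR_ge0.
transitivity (\int[lebesgue_measure]_x F x)%E.
  transitivity (\int[P]_w (cst 1%R w * g (X w))%:E)%E.
    by apply: eq_integral => w _; rewrite mul1r.
  (* The weight is 1 under [P] and the Laplace density under Lebesgue measure; on indicators this is
     the definition of the distribution. *)
  apply: (@ge0_integral_comp_indic _ _ _ _ _ P lebesgue_measure X id (cst 1)
    (@laplace_pdf R)) => //; last by move=> x; exact: expR_ge0.
  - exact: measurable_laplace_pdf.
  - exact: laplace_pdf_ge0.
  move=> A mA; transitivity (P (X @^-1` A)).
    rewrite [LHS](_ : _ = \int[P]_w (\1_(X @^-1` A) w)%:E)%E; last first.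
      by apply: eq_integral => w _; rewrite mul1r.
    by rewrite integral_indic// ?setIT// -[X in measurable X]setTI; exact: mX.
  rewrite HX// [LHS]integral_mkcond; apply: eq_integral => x _.
  by rewrite patchE indicE; case: ifP => _; rewrite ?mulr1 ?mulr0.
have FE c x : (b * x - s * `|x| = - c * x) -> F x = ((s^-1)%:E * (expR (- c * x))%:E)%E.
  by move=> <-; rewrite /F /laplace_pdf -/s /g -mulrA -expRD -EFinM (addrC (b * x)).
have half (c : R) (G : R -> \bar R) : 0 < c ->
    (forall x, 0 <= x -> G x = ((s^-1)%:E * (expR (- c * x))%:E)%E) ->
    (\int[lebesgue_measure]_(x in `[0%R, +oo[) G x = (s^-1 * c^-1)%:E)%E.
  move=> c0 GE; 
  transitivity (\int[lebesgue_measure]_(x in `[0%R, +oo[)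
      ((s^-1)%:E * (expR (- c * x))%:E))%E.
    by apply: eq_integral => x; rewrite inE/= in_itv/= andbT => /GE.
  rewrite ge0_integralZl//.
  - by rewrite integral_expR_neg// EFinM.
  - apply/measurable_EFinP; apply: (measurableT_comp (@measurable_expR R)).
    exact: mulrl_measurable.
  - by rewrite lee_fin invr_ge0 ltW.
rewrite -(setUv (`[0%R, +oo[)) ge0_integral_setU//=; last 3 first.
- exact: measurableC.
- by rewrite setUv.
- exact/disj_setPCl.
(* The null endpoint 0 is added so that x |-> -x maps this half-line onto [[0, +oo[]. *)
rewrite setCitvr/= (@integral_itv_bndo_bndc R -oo%O 0%R F); last first.
  exact: measurable_funS mF.
have -> : (\int[lebesgue_measure]_(x in `]-oo, 0%R]) F x =
    \int[lebesgue_measure]_(x in `[0%R, +oo[) F (- x)%R)%E.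
  rewrite (@ge0_integration_by_substitution0 R (fun x => F (- x)%R))//.
  - by under [in RHS]eq_integral do rewrite opprK.
  - exact: measurableT_comp mF _.
rewrite (half (s - b) F)//; last 2 first.
- by rewrite subr_gt0; case/andP: bs.
- by move=> x x0; apply: FE; rewrite ger0_norm//; ring.
rewrite (half (s + b) (fun x => F (- x)))//; last 2 first.
- by rewrite -ltrBlDl sub0r; case/andP: bs.
- move=> x x0; rewrite (FE (- (s + b)))//; first by rewrite mulrNN mulNr.
  by rewrite normrN ger0_norm//; ring.
have [sb0 sb1] : 0 < s - b /\ 0 < s + b by lra.
have -> : 2 - b ^+ 2 = (s - b) * (s + b) by rewrite -s2; ring.
by rewrite -EFinD; congr EFin; field; rewrite !lt0r_neq0.
Qed.

(** * Tail bounds *)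

Lemma markov_ineq (R : realType) (dO : measure_display)
    (Omega : measurableType dO) (P : probability Omega R) (f : Omega -> R)
    (A : set Omega) (c : R) :
  measurable_fun setT f -> (forall w, 0 <= f w) -> measurable A -> 0 <= c ->
  (forall w, A w -> c <= f w) ->
  (c%:E * P A <= \int[P]_w (f w)%:E)%E.
Proof.
move=> mf f0 mA c0 Af.
rewrite -[P A](_ : (\int[P]_w (\1_A w)%:E)%E = _); last by rewrite integral_indic// setIT.
have mA1 : measurable_fun setT (fun w => (\1_A w)%:E : \bar R).
  by apply/measurable_EFinP; exact: measurable_indic.
rewrite -ge0_integralZl//.
apply: ge0_le_integral => //.
- by move=> w _; rewrite -EFinM lee_fin mulr_ge0.
- exact: measurable_funeM.
- exact/measurable_EFinP.
move=> w _; rewrite -EFinM lee_fin indicE; case: (boolP (w \in A)) => [/set_mem|_].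
  by move=> /Af; rewrite mulr1.
by rewrite mulr0.
Qed.

(** By expR y >= 1 + y and (2 - y)(1 + y) = 2 + y (1 - y) >= 2. *)
Lemma div_le_expR (R : realType) (y : R) : 0 <= y <= 1 -> 2 / (2 - y) <= expR y.
Proof.
move=> /andP[y0 y1]; rewrite ler_pdivrMr; last by lra.
have := @expR_ge1Dx R y; nra.
Qed.

(** Chernoff bound with exponent 1 / sigma. The coefficients a_j / sigma have squares summing to at
    most 1, so each is small enough for [laplace_mgf], and the product of the moments is at most exp
    1. *)
Lemma laplace_sum_upper_tail (R : realType) (dO : measure_display)
    (Omega : measurableType dO) (P : probability Omega R) (Z : nat -> Omega -> R)
    (a : nat -> R) (n : nat) (sigma x : R) :
  (forall j, laplace_distributed P (Z j)) -> mutually_independent P Z ->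
  0 < sigma -> \sum_(j < n) a j ^+ 2 <= sigma ^+ 2 ->
  (P [set w | (x * sigma <= \sum_(j < n) a j * Z j w)%R] <= (expR (1 - x))%:E)%E.
Proof.
move=> lapZ indZ s0 as2.
have mZ j : measurable_fun setT (Z j) by case: (lapZ j).
(* The value 0 beyond n makes |b j| <= 1 hold for every index, as [expectation_prod_indep] wants all
   the moments. *)
pose b j := if (j < n)%N then a j / sigma else 0.
have sb : \sum_(j < n) b j ^+ 2 <= 1.
  rewrite (eq_bigr (fun j : 'I_n => (sigma ^+ 2)^-1 * a j ^+ 2)); last first.
    by move=> j _; rewrite /b ltn_ord expr_div_n mulrC.
  by rewrite -big_distrr/= mulrC ler_pdivrMr ?exprn_gt0// mul1r.
have b2 j : b j ^+ 2 <= 1.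
  have [jn|nj] := ltnP j n; last by rewrite /b ltnNge nj/= expr0n.
  rewrite (le_trans _ sb)// (bigD1 (Ordinal jn))//= lerDl.
  by apply: sumr_ge0 => *; rewrite sqr_ge0.
have b1 j : `|b j| <= 1 by rewrite -(@expr_le1 _ 2)// real_normK ?num_real.
pose f j y := expR (b j * y).
have mf j : measurable_fun setT (f j).
  apply: (measurableT_comp (@measurable_expR R)); exact: mulrl_measurable.
have E : (\int[P]_w (\prod_(j < n) f j (Z j w))%:E =
    (\prod_(j < n) (2 / (2 - b j ^+ 2)))%:E)%E.
  apply: (expectation_prod_indep (e := fun j => 2 / (2 - b j ^+ 2))) => //.
  - by move=> j y; exact: expR_ge0.
  - by move=> j; exact: laplace_mgf.
have mS : measurable_fun setT (fun w => \sum_(j < n) a j * Z j w).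
  by apply: measurable_sum => j _; apply: measurable_funM.
have mA : measurable [set w | x * sigma <= \sum_(j < n) a j * Z j w].
  rewrite (_ : [set w | _] = (fun w => \sum_(j < n) a j * Z j w) @^-1` `[x * sigma, +oo[%classic).
    by rewrite -[X in measurable X]setTI; exact: mS.
  by apply/seteqP; split=> w /=; rewrite in_itv/= andbT.
have : ((expR x)%:E * P [set w | (x * sigma <= \sum_(j < n) a j * Z j w)%R] <=
    (\prod_(j < n) (2 / (2 - b j ^+ 2)))%:E)%E.
  rewrite -E; apply: markov_ineq => //.
  - by apply: measurable_prod => j _; exact: measurableT_comp.
  - by move=> w; apply: prodr_ge0 => j _; exact: expR_ge0.
  move=> w /=; rewrite -ler_pdivlMr// => xS.
  rewrite /f -expR_sum ler_expR (le_trans xS)// big_distrl/= le_eqVlt; apply/orP; left.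
  by apply/eqP/eq_bigr => j _; rewrite /b ltn_ord mulrAC.
have : P [set w | x * sigma <= \sum_(j < n) a j * Z j w] \is a fin_num.
  exact: fin_num_measure.
case: (P _) => [p| |]// _; rewrite -EFinM !lee_fin => H.
rewrite expRD expRN ler_pdivlMr ?expR_gt0// mulrC (le_trans H)//.
apply: (@le_trans _ _ (\prod_(j < n) expR (b j ^+ 2))).
  apply: ler_prod => j _; rewrite div_le_expR ?sqr_ge0 ?b2// andbT.
  by rewrite divr_ge0// subr_ge0 (le_trans (b2 j))// ler1n.
by rewrite -expR_sum ler_expR.
Qed.

Lemma laplace_sum_tail (R : realType) (dO : measure_display)
    (Omega : measurableType dO) (P : probability Omega R) (Z : nat -> Omega -> R)
    (a : nat -> R) (n : nat) (sigma x : R) :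
  (forall j, laplace_distributed P (Z j)) -> mutually_independent P Z ->
  0 < sigma -> \sum_(j < n) a j ^+ 2 <= sigma ^+ 2 ->
  (P [set w | (x * sigma <= `|\sum_(j < n) a j * Z j w|)%R] <= (2 * expR (1 - x))%:E)%E.
Proof.
move=> lapZ indZ s0 as2.
have mS c : measurable [set w | x * sigma <= \sum_(j < n) c j * Z j w].
  have mS : measurable_fun setT (fun w => \sum_(j < n) c j * Z j w).
    by apply: measurable_sum => j _; apply: measurable_funM => //; case: (lapZ j).
  rewrite (_ : [set w | _] = (fun w => \sum_(j < n) c j * Z j w) @^-1` `[x * sigma, +oo[%classic).
    by rewrite -[X in measurable X]setTI; exact: mS.
  by apply/seteqP; split=> w /=; rewrite in_itv/= andbT.
rewrite (_ : [set w | _] = [set w | x * sigma <= \sum_(j < n) a j * Z j w] `|`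
    [set w | x * sigma <= \sum_(j < n) - a j * Z j w]); last first.
  apply/seteqP; split=> w /=.
    rewrite ler_normr => /orP[|]; [by left|right].
    by under eq_bigr do rewrite mulNr; rewrite sumrN.
  case=> [h|]; first by rewrite ler_normr h.
  by under eq_bigr do rewrite mulNr; rewrite sumrN ler_normr => ->; rewrite orbT.
rewrite (le_trans (measureU2 _ (mS a) (mS (fun j => - a j))))//.
rewrite mulr_natl mulr2n EFinD leeD//.
  exact: laplace_sum_upper_tail.
apply: (laplace_sum_upper_tail (a := fun j => - a j)) => //.
by under eq_bigr do rewrite sqrrN.
Qed.

Lemma measurable_norm_ge (R : realType) (dO : measure_display)
    (Omega : measurableType dO) (f : Omega -> R) (c : R) :
  measurable_fun setT f -> measurable [set w | c <= `|f w|].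
Proof.
move=> mf; rewrite (_ : [set w | _] = (Num.norm \o f) @^-1` `[c, +oo[%classic).
  by rewrite -[X in measurable X]setTI; apply: measurableT_comp.
by apply/seteqP; split=> w /=; rewrite in_itv/= andbT.
Qed.

(** If |X - Y| >= 2c, then |X_n - Y_n| >= c or one of the two approximation errors is at least c /
    2. By Chebyshev's inequality the latter events have probability tending to 0. *)
Lemma tail_of_L2_limit (R : realType) (dO : measure_display)
    (Omega : measurableType dO) (P : probability Omega R)
    (X Y : Omega -> R) (X_ Y_ : nat -> Omega -> R) (c : R) (K : \bar R) :
  measurable_fun setT X -> measurable_fun setT Y ->
  (forall n, measurable_fun setT (X_ n)) -> (forall n, measurable_fun setT (Y_ n)) ->
  (fun n => \int[P]_w ((X w - X_ n w) ^+ 2)%:E)%E @ \oo --> 0%E ->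
  (fun n => \int[P]_w ((Y w - Y_ n w) ^+ 2)%:E)%E @ \oo --> 0%E ->
  0 < c ->
  (forall n, P [set w | (c <= `|X_ n w - Y_ n w|)%R] <= K)%E ->
  (P [set w | (2 * c <= `|X w - Y w|)%R] <= K)%E.
Proof.
move=> mX mY mX_ mY_ cX cY c0 HK.
pose d : R := (c / 2) ^+ 2.
have d0 : 0 < d by rewrite exprn_gt0// divr_gt0.
have cheb (U V : Omega -> R) : measurable_fun setT U -> measurable_fun setT V ->
    (P [set w | (c / 2 <= `|U w - V w|)%R] <= (d^-1)%:E * \int[P]_w ((U w - V w) ^+ 2)%:E)%E.
  move=> mU mV; rewrite lee_pdivlMl//; apply: markov_ineq.
  - by apply: measurable_funX; exact: measurable_funB.
  - by move=> w; exact: sqr_ge0.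
  - by apply: measurable_norm_ge; exact: measurable_funB.
  - exact: ltW.
  by move=> w /= h; rewrite -(real_normK (num_real _)) lerXn2r ?nnegrE// ltW// divr_gt0.
have lim : ((fun n => K + ((d^-1)%:E * \int[P]_w ((X w - X_ n w) ^+ 2)%:E +
    (d^-1)%:E * \int[P]_w ((Y w - Y_ n w) ^+ 2)%:E)) @ \oo --> K)%E.
  rewrite -[X in _ --> X]adde0; apply: cvgeD; first by rewrite fin_num_adde_defl.
    exact: cvg_cst.
  rewrite -[X in _ --> X]adde0; apply: cvgeD => //.
    by rewrite -(mule0 (d^-1)%:E); apply: cvgeZl.
  by rewrite -(mule0 (d^-1)%:E); apply: cvgeZl.
rewrite -(cvg_lim (@ereal_hausdorff R) lim); apply: lime_ge; first by apply/cvg_ex; exists K.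
apply: nearW => n.
apply: le_trans (leeD (HK n) (leeD (cheb X (X_ n) mX (mX_ n))
  (cheb Y (Y_ n) mY (mY_ n)))).
have mn (U V : Omega -> R) : measurable_fun setT U -> measurable_fun setT V -> forall e : R,
    measurable [set w : Omega | (e <= `|U w - V w|)%R].
  by move=> mU mV e; apply: measurable_norm_ge; exact: measurable_funB.
set A1 := [set w | _ <= `|X_ n w - _|]; set A2 := [set w | _ <= `|X w - X_ n w|].
set A3 := [set w | _ <= `|Y w - Y_ n w|].
apply: (@le_trans _ _ (P (A1 `|` (A2 `|` A3)))).
  apply: le_measure; rewrite ?inE; [exact: mn|do ?apply: measurableU; exact: mn|].
  move=> w /= h; rewrite /A1 /A2 /A3 /=.
  have [|h1] := leP c `|X_ n w - Y_ n w|; first by left.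
  have [|h2] := leP (c / 2) `|X w - X_ n w|; first by right; left.
  right; right; rewrite leNgt; apply/negP => h3.
  have : `|X w - Y w| < 2 * c.
    rewrite (_ : X w - Y w = (X w - X_ n w) + (X_ n w - Y_ n w) - (Y w - Y_ n w)); last by ring.
    apply: le_lt_trans (ler_normB _ _) _.
    apply: le_lt_trans (lerD (ler_normD _ _) (lexx _)) _; lra.
  by rewrite ltNge h.
rewrite (le_trans (measureU2 _ _ _))//; [exact: mn|by apply: measurableU; exact: mn|].
by rewrite leeD// measureU2//; exact: mn.
Qed.

(** * Chaining over a compact set *)

(* Comparing level k at s with level k + 1 at t handles at once the convergence
   (take s = t) and the continuity of the limit. *)
Lemma chained_limit (R : realType) (V : normedModType R) (T : set V)
    (f : nat -> V -> R) (A rho : R) (k0 : nat) :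
  0 <= A -> 0 < rho < 1 ->
  (forall k s t, (k0 <= k)%N -> T s -> T t -> `|s - t| <= 2^-1 ^+ k ->
     `|f k s - f k.+1 t| <= A * rho ^+ k) ->
  (forall t, T t -> cvgn (f ^~ t)) /\
  {within T, continuous (fun t => limn (f ^~ t))}.
Proof.
move=> A0 /andP[rho0 rho1] H.
have r1 : 0 < 1 - rho by rewrite subr_gt0.
pose B := A / (1 - rho).
have B0 : 0 <= B by rewrite divr_ge0// ltW.
(* The bound is the exact finite geometric sum, so the induction closes with equality. *)
have step k t : (k0 <= k)%N -> T t -> forall n,
    `|f k t - f (k + n)%N t| <= B * rho ^+ k * (1 - rho ^+ n).
  move=> kk Tt; elim=> [|n IH]; first by rewrite addn0 subrr normr0 expr0 subrr mulr0.
  rewrite (_ : f k t - _ = (f k t - f (k + n)%N t) +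
    (f (k + n)%N t - f (k + n.+1)%N t)); last by ring.
  rewrite (le_trans (ler_normD _ _))//.
  have h : `|f (k + n)%N t - f (k + n.+1)%N t| <= A * rho ^+ (k + n).
    rewrite addnS; apply: H => //; first by rewrite (leq_trans kk)// leq_addr.
    by rewrite subrr normr0 exprn_ge0.
  rewrite (le_trans (lerD IH h))// /B exprD exprS le_eqVlt; apply/orP; left; apply/eqP.
  by field; rewrite lt0r_neq0.
have stepB k t n : (k0 <= k)%N -> T t -> (k <= n)%N -> `|f k t - f n t| <= B * rho ^+ k.
  move=> kk Tt kn; rewrite -(subnKC kn); apply: le_trans (step _ _ kk Tt _) _.
  have rn m : 0 <= rho ^+ m by rewrite exprn_ge0// ltW.
  by apply: ler_piMr; [exact: mulr_ge0|rewrite gerBl].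
have small (c e : R) : 0 <= c -> 0 < e -> exists2 k, (k0 <= k)%N & c * rho ^+ k <= e.
  move=> c0 e0.
  have := @cvg_geometric R c rho; rewrite ger0_norm ?(ltW rho0)// => /(_ rho1).
  move=> /cvgr0Pnorm_le/(_ _ e0)[N _ /(_ (maxn N k0) (leq_maxl _ _))].
  rewrite /geometric/= => h; exists (maxn N k0); first exact: leq_maxr.
  by apply: le_trans h; rewrite ler_norm.
have cvgf t : T t -> cvgn (f ^~ t).
  move=> Tt; apply/cauchy_cvgP/cauchy_exP => e e0.
  have [k kk hk] := small B (e / 2) B0 (divr_gt0 e0 (@ltr0n R 2)).
  exists (f k t); change (\forall n \near \oo, ball (f k t) e (f n t)).
  near=> n; rewrite /ball/=.
  apply: le_lt_trans (stepB k t n kk Tt _) _; first by near: n; exact: nbhs_infty_ge.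
  by apply: le_lt_trans hk _; rewrite ltr_pdivrMr// mulr_natr mulr2n ltrDl.
split=> //; pose F t := limn (f ^~ t).
have Flim k t : (k0 <= k)%N -> T t -> `|f k t - F t| <= B * rho ^+ k.
  move=> kk Tt.
  have /cvg_norm c : (fun n => f k t - f n t) @ \oo --> f k t - F t.
    by apply: cvgB; [exact: cvg_cst|exact: cvgf].
  rewrite -(cvg_lim (@Rhausdorff R) c); apply: limr_le; first by apply/cvg_ex; eexists; exact: c.
  by near=> n; apply: stepB => //; near: n; exact: nbhs_infty_ge.
apply/subspace_continuousP => x Tx; apply/cvgrPdist_le => e e0.
(* F x - F s is split through f k x and f k.+1 s: the two limits cost [B] each and the comparison of
   levels costs [A]. *)
have c0 : 0 <= 2 * B + A by rewrite addr_ge0// mulr_ge0.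
have [k kk hk] := small _ _ c0 e0.
rewrite near_withinE; apply/nbhs_normP; exists (2^-1 ^+ k).
  by rewrite /= exprn_gt0// invr_gt0.
move=> s /= xs Ts; rewrite -/(F x) -/(F s).
rewrite (_ : F x - F s = - (f k x - F x) + (f k x - f k.+1 s) + (f k.+1 s - F s)); last by ring.
rewrite (le_trans (ler_normD _ _))// (le_trans (lerD (ler_normD _ _) (lexx _)))// normrN.
apply: le_trans hk; rewrite mulrDl -addrA.
rewrite [X in _ <= X](_ : _ = B * rho ^+ k + (A * rho ^+ k + B * rho ^+ k)); last by ring.
apply: lerD; first exact: Flim.
apply: lerD; first by apply: H => //; exact: ltW.
apply: le_trans (Flim _ _ (leqW kk) Ts) _.
by rewrite ler_wpM2l// exprS ler_piMl ?exprn_ge0// ltW.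
Unshelve. all: by end_near.
Qed.

Lemma coord_le_norm (R : realType) (d : nat) (v : 'rV[R]_d) (i : 'I_d) :
  `|v ord0 i| <= `|v|.
Proof.
rewrite [leRHS]/Num.norm/= mx_normrE.
exact: (@le_bigmax _ _ _ _ (fun ij => `|v ij.1 ij.2|) (ord0, i)).
Qed.

Lemma compact_bounded_coord (R : realType) (d : nat) (T : set 'rV[R]_d) :
  compact T -> exists2 N : nat, (0 < N)%N & forall t i, T t -> `|t ord0 i| < N%:R.
Proof.
move=> cT.
have [M [_ /(_ (M + 1))]] := compact_bounded cT; rewrite ltrDl ltr01 => /(_ isT) TM.
exists (Num.truncn (M + 1)).+1 => // t i Tt.
apply: (@le_lt_trans _ _ (M + 1)); last exact: truncnS_gt.
exact: le_trans (coord_le_norm _ _) (TM t Tt).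
Qed.

Lemma mx_norm_le (R : realType) (m n : nat) (x : 'M[R]_(m, n)) (e : R) :
  0 <= e -> (forall i j, `|x i j| <= e) -> `|x| <= e.
Proof.
move=> e0 xe; rewrite /Num.norm/= mx_normrE.
by apply/bigmax_leP; split=> // -[i j] _; exact: xe.
Qed.

(** The cube of t is coded by the integer parts of its rescaled coordinates, and t is sent to one
    chosen point of T in that cube. Points with equal codes differ by less than 2^-k in each
    coordinate. *)
Lemma grid_projection (R : realType) (d : nat) (T : set 'rV[R]_d) (N k : nat) :
  (0 < N)%N -> (forall t i, T t -> `|t ord0 i| < N%:R) ->
  exists (L : seq 'rV[R]_d) (proj : 'rV[R]_d -> 'rV[R]_d),
    (size L <= (4 * N * 2 ^ k) ^ d)%N /\
    forall t, T t -> [/\ T (proj t), proj t \in L & `|t - proj t| <= 2^-1 ^+ k].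
Proof.
move=> N0 TN.
pose m := (2 * N * 2 ^ k)%N.
(* The shift by N makes u nonnegative on T, where truncation is the integer part; there u is also at
   most [m]. *)
pose u (t : 'rV[R]_d) (i : 'I_d) : R := 2 ^+ k * (t ord0 i + N%:R).
pose code t : {ffun 'I_d -> 'I_m.+1} := [ffun i => inord (Num.truncn (u t i))].
(* The default 0 occurs only for codes of cubes missing T, which no point of T has. *)
pose rep c := xget (0 : 'rV[R]_d) [set s | T s /\ code s = c].
exists [seq rep c | c <- enum {: {ffun 'I_d -> 'I_m.+1}}], (rep \o code); split.
  rewrite size_map -cardE card_ffun !card_ord.
  have mle : (m.+1 <= 4 * N * 2 ^ k)%N.
    rewrite /m (_ : 4 * N = 2 * N + 2 * N)%N; last by rewrite -mulnDl.
    rewrite mulnDl.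
    by rewrite -addn1 leq_add2l !muln_gt0 N0 expn_gt0.
  case: (posnP d) => [->|d0]; first by rewrite !expn0.
  by rewrite leq_exp2r.
move=> t Tt.
have [Tr cr] : T (rep (code t)) /\ code (rep (code t)) = code t.
  by apply: (@xgetPex _ 0 [set s | T s /\ code s = code t]); exists t.
split => //; first by apply: map_f; rewrite mem_enum.
apply: mx_norm_le; first by rewrite exprn_ge0// invr_ge0.
have u_ge0 s i : T s -> 0 <= u s i.
  move=> /TN -/(_ i); rewrite ltr_norml => /andP[h _].
  by rewrite mulr_ge0 ?exprn_ge0// -lerBlDr sub0r ltW.
have u_lt s i : T s -> (Num.truncn (u s i) < m.+1)%N.
  move=> Ts; rewrite ltnS -(@ler_nat R) (@le_trans _ _ (u s i))// ?truncn_le ?u_ge0//.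
  rewrite /m /u mulrC natrM natrX ler_wpM2r ?exprn_ge0//.
  move: (TN _ i Ts); rewrite ltr_norml => /andP[_ /ltW h].
  by rewrite natrM mulr_natl mulr2n lerD2r.
move=> i j; rewrite ord1 !mxE.
have : Num.truncn (u (rep (code t)) j) = Num.truncn (u t j).
  by move/ffunP/(_ j): cr; rewrite !ffunE => /(congr1 val); rewrite /= !inordK ?u_lt.
have /andP[a1 a2] := truncn_itv (u_ge0 _ j Tr).
have /andP[b1 b2] := truncn_itv (u_ge0 _ j Tt).
move=> E; rewrite E in a1 a2.
have p0 : 0 < (2 : R) ^+ k by rewrite exprn_gt0.
rewrite exprVn -[leRHS]mul1r ler_pdivlMr// -[X in _ * X](gtr0_norm p0) -normrM.
rewrite [X in `|X|](_ : _ = u t j - u (rep (code t)) j); last by rewrite /u; ring.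
rewrite -natr1 in a2 b2.
by rewrite ler_norml; apply/andP; split; lra.
Qed.

(** * Borel-Cantelli and the construction of a modification *)

Lemma measure_bigsetU_le (R : realType) (dO : measure_display)
    (Omega : measurableType dO) (P : {measure set Omega -> \bar R})
    (I : Type) (s : seq I) (F : I -> set Omega) (c : R) :
  (forall i, measurable (F i)) -> (forall i, (P (F i) <= c%:E)%E) ->
  (P (\big[setU/set0]_(i <- s) F i) <= ((size s)%:R * c)%:E)%E.
Proof.
move=> mF Fc; elim: s => [|i s IH]; first by rewrite big_nil measure0 mul0r.
rewrite big_cons (le_trans (measureU2 _ _ _))//; first exact: bigsetU_measurable.
by rewrite /= -natr1 mulrDl mul1r addrC EFinD leeD.
Qed.

Lemma lim_sup_set_geometric (R : realType) (dO : measure_display)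
    (Omega : measurableType dO) (P : {measure set Omega -> \bar R})
    (F : (set Omega)^nat) (c : R) :
  0 <= c -> (forall k, measurable (F k)) ->
  (forall k, (P (F k) <= (c / 2 ^+ k)%:E)%E) -> P (lim_sup_set F) = 0%E.
Proof.
move=> c0 mF Fc; apply: lim_sup_set_cvg0 => //.
(* The terms c / 2^k are rewritten with k + 1 in the exponent to match the series of
   [epsilon_trick0], of sum 2c. *)
apply: (@le_lt_trans _ _ (\sum_(k <oo) ((2 * c) / (2 ^ k.+1)%:R)%:E)%E).
  apply: lee_nneseries => // k _; apply: le_trans (Fc k) _.
  rewrite lee_fin natrX exprS -mulf_div divff ?mul1r//.
by apply: le_lt_trans (epsilon_trick0 _ _) _; rewrite ?ltry// mulr_ge0.
Qed.

Lemma not_lim_sup_set T (F : (set T)^nat) x :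
  ~ lim_sup_set F x -> exists k0, forall k, (k0 <= k)%N -> ~ F k x.
Proof.
move=> /existsNP[k0 /not_implyP[_ h]]; exists k0 => k kk Fx.
by apply: h; exists k.
Qed.

Lemma measurable_lim_sup_set (dO : measure_display) (Omega : measurableType dO)
    (F : (set Omega)^nat) :
  (forall k, measurable (F k)) -> measurable (lim_sup_set F).
Proof.
by move=> mF; apply: bigcap_measurable => // k _; exact: bigcup_measurable.
Qed.

(* The rate (2 * 4 ^ d) ^ - k in the tail hypothesis absorbs the at most
   O(4 ^ (d k)) pairs of grid points of levels k and k + 1. *)
Lemma chaining_modification (R : realType) (d : nat) (T : set 'rV[R]_d)
    (dO : measure_display) (Omega : measurableType dO) (P : probability Omega R)
    (Z : 'rV[R]_d -> Omega -> R) (A rho K : R) :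
  compact T -> 0 <= A -> 0 < rho < 1 -> 0 <= K ->
  (forall t, T t -> measurable_fun setT (Z t)) ->
  (forall k p q, T p -> T q -> `|p - q| <= 3 * 2^-1 ^+ k ->
    (P [set w | (A * rho ^+ k <= `|Z p w - Z q w|)%R] <=
      (K / (2 * 4 ^+ d) ^+ k)%:E)%E) ->
  exists Zt : 'rV[R]_d -> Omega -> R,
    (forall t, T t -> measurable_fun setT (Zt t)) /\
    (forall w, {within T, continuous (fun t => Zt t w)}) /\
    (forall t, T t -> P [set w | Zt t w = Z t w] = 1%E).
Proof.
move=> cT A0 rho01 K0 mZ tail.
have [N N0 TN] := compact_bounded_coord cT.
have /choice[Lproj HL] : forall k, exists Lproj : seq 'rV[R]_d * ('rV[R]_d -> 'rV[R]_d),
    (size Lproj.1 <= (4 * N * 2 ^ k) ^ d)%N /\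
    forall t, T t -> [/\ T (Lproj.2 t), Lproj.2 t \in Lproj.1 &
      `|t - Lproj.2 t| <= 2^-1 ^+ k].
  by move=> k; have [L [proj h]] := grid_projection k N0 TN; exists (L, proj).
pose L k := (Lproj k).1; pose proj k := (Lproj k).2.
(* The factor 3 counts the hops from [proj k s] to s, to t and to [proj k.+1 t], each of length at
   most 2^-k. *)
pose ok k (pq : 'rV[R]_d * 'rV[R]_d) :=
  [/\ T pq.1, T pq.2 & `|pq.1 - pq.2| <= 3 * 2^-1 ^+ k].
pose jump k pq : set Omega := if `[< ok k pq >]
  then [set w | A * rho ^+ k <= `|Z pq.1 w - Z pq.2 w|] else set0.
pose bad k := \big[setU/set0]_(pq <- [seq (p, q) | p <- L k, q <- L k.+1]) jump k pq.
have mjump k pq : measurable (jump k pq).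
  rewrite /jump; case: asboolP => // -[Tp Tq _]; apply: measurable_norm_ge.
  by apply: measurable_funB; exact: mZ.
have mbad k : measurable (bad k) by apply: bigsetU_measurable => pq _; exact: mjump.
have Kk k : 0 <= K / (2 * 4 ^+ d) ^+ k by rewrite divr_ge0// exprn_ge0// mulr_ge0// exprn_ge0.
(* The number of pairs is at most ((4 N 2^k)(4 N 2^(k+1)))^d = (32 N^2 4^k)^d; the factor 4^(dk)
   cancels against the tail rate and leaves c / 2^k. *)
pose c : R := (32 * N * N)%:R ^+ d * K.
have badP k : (P (bad k) <= (c / 2 ^+ k)%:E)%E.
  apply: (le_trans (measure_bigsetU_le (c := K / (2 * 4 ^+ d) ^+ k) _ _ _)) => //.
    move=> pq; rewrite /jump; case: asboolP => [[Tp Tq pq3]|_]; first exact: tail.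
    by rewrite measure0 lee_fin.
  rewrite lee_fin size_allpairs.
  have sL : (size (L k) * size (L k.+1) <= ((32 * N * N) * 4 ^ k) ^ d)%N.
    apply: leq_trans (leq_mul (HL k).1 (HL k.+1).1) _.
    rewrite -expnMn; apply: eq_leq; congr (_ ^ _)%N.
    rewrite (_ : 4 ^ k = 2 ^ k * 2 ^ k)%N; last by rewrite -expnMn.
    by rewrite expnS; ring.
  apply: (@le_trans _ _ ((((32 * N * N) * 4 ^ k) ^ d)%N%:R * (K / (2 * 4 ^+ d) ^+ k))).
    by rewrite ler_wpM2r// ler_nat.
  have -> : (((32 * N * N) * 4 ^ k) ^ d)%N%:R = (32 * N * N)%:R ^+ d * (4 ^+ d) ^+ k :> R.
    by rewrite natrX natrM exprMn natrX -!exprM (mulnC k d).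
  have : (4 ^+ d) ^+ k != 0 :> R by rewrite !expf_neq0.
  have : (2 : R) ^+ k != 0 by rewrite expf_neq0.
  rewrite /c exprMn; move: ((2 : R) ^+ k) (((4 : R) ^+ d) ^+ k) ((32 * N * N)%:R ^+ d).
  move=> x y z x0 y0.
  by rewrite le_eqVlt; apply/orP; left; apply/eqP; field; rewrite x0 y0.
pose G := ~` lim_sup_set bad.
have mG : measurable G by apply/measurableC/measurable_lim_sup_set.
have c0 : 0 <= c by rewrite mulr_ge0// exprn_ge0.
have PG : P (lim_sup_set bad) = 0%E by exact: (lim_sup_set_geometric c0).
have chain w : G w -> exists k0, forall k s t, (k0 <= k)%N -> T s -> T t ->
    `|s - t| <= 2^-1 ^+ k -> `|Z (proj k s) w - Z (proj k.+1 t) w| <= A * rho ^+ k.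
  move=> Gw; have [k0 h] := not_lim_sup_set Gw; exists k0 => k s t kk Ts Tt st.
  have [T1 L1 d1] := (HL k).2 s Ts; have [T2 L2 d2] := (HL k.+1).2 t Tt.
  rewrite leNgt; apply/negP => /ltW lt; apply: (h k kk).
  rewrite /bad -bigcup_seq; exists (proj k s, proj k.+1 t).
    by rewrite /=; apply/allpairsP; exists (proj k s, proj k.+1 t).
  rewrite /jump; case: asboolP => // -[]; split => //=.
  rewrite (_ : proj k s - _ = - (s - proj k s) + (s - t) + (t - proj k.+1 t)); last first.
    by rewrite opprB !subrKA.
  apply: le_trans (ler_normD _ _) _.
  apply: (@le_trans _ _ (2^-1 ^+ k + 2^-1 ^+ k + 2^-1 ^+ k)); last by lra.
  apply: lerD; last first.
    by apply: le_trans d2 _; rewrite exprS ler_piMl ?exprn_ge0// invf_le1// ler1n.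
  by apply: le_trans (ler_normD _ _) _; rewrite normrN; exact: lerD.
(* The indicator replaces the exceptional paths by 0, so that convergence and continuity hold for
   every outcome and [Zt t] is measurable as a pointwise limit. *)
pose f w k t := \1_G w * Z (proj k t) w.
pose Zt t w := limn (fun k => f w k t).
have fG w : G w -> f w = fun k t => Z (proj k t) w.
  by move=> Gw; apply/funext => k; apply/funext => t; rewrite /f indicE mem_set// mul1r.
have fNG w : ~ G w -> f w = fun k t => 0.
  by move=> Gw; apply/funext => k; apply/funext => t; rewrite /f indicE memNset// mul0r.
have cvgf w t : T t -> (fun k => f w k t) @ \oo --> Zt t w.
  move=> Tt; have [Gw|nG] := pselect (G w); last first.
    by rewrite /Zt fNG// lim_cst//; exact: cvg_cst.
  have [k0 h] := chain w Gw.
  rewrite /Zt fG//; exact: (chained_limit A0 rho01 h).1.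
have mZt t : T t -> measurable_fun setT (Zt t).
  move=> Tt; apply: (@measurable_fun_cvg _ _ _ _ (fun k w => f w k t)).
    move=> k; apply: measurable_funM; first exact: measurable_indic.
    by apply: mZ; case: ((HL k).2 t Tt).
  by move=> w _; exact: cvgf.
exists Zt; split; [exact: mZt|split].
  move=> w; have [Gw|nG] := pselect (G w).
    have [k0 h] := chain w Gw.
    by rewrite /Zt fG//; exact: (chained_limit A0 rho01 h).2.
  rewrite (_ : (fun t => _) = cst 0); first exact: cst_continuous.
  by apply/funext => t; rewrite /Zt fNG// lim_cst.
move=> t Tt.
(* At a fixed t, a second use of Borel-Cantelli gives Z (proj k t) -> Z t almost surely, which
   identifies the limit. This null set depends on t. *)
pose E k := [set w | A * rho ^+ k <= `|Z (proj k t) w - Z t w|].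
have mE k : measurable (E k).
  have [Tp _ _] := (HL k).2 t Tt.
  by apply: measurable_norm_ge; apply: measurable_funB; exact: mZ.
have PE : P (lim_sup_set E) = 0%E.
  apply: (lim_sup_set_geometric K0) => // k.
  have [Tp _ dp] := (HL k).2 t Tt.
  apply: le_trans (tail k _ _ Tp Tt _) _.
    rewrite distrC (le_trans dp)// ler_peMl ?exprn_ge0//; lra.
  rewrite lee_fin ler_wpM2l// lef_pV2 ?posrE ?exprn_gt0 ?mulr_gt0 ?exprn_gt0//.
  by rewrite lerXn2r ?nnegrE ?mulr_ge0 ?exprn_ge0// ler_peMr// exprn_ege1// ler1n.
have sub : ~` [set w | Zt t w = Z t w] `<=` lim_sup_set bad `|` lim_sup_set E.
  move=> w /= ne; apply: contrapT => /not_orP[Gw nE]; apply: ne.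
  have [k0 h] := not_lim_sup_set nE.
  have c1 := cvgf w t Tt; rewrite fG// in c1.
  apply: (cvg_unique _ c1) => //.
  apply/cvgrPdist_le => e e0.
  have /andP[r0 r1] := rho01.
  have := @cvg_geometric R A rho; rewrite (ger0_norm (ltW r0)).
  move=> /(_ r1) /cvgr0Pnorm_le/(_ _ e0)[N1 _ hN].
  exists (maxn N1 k0) => // k /=; rewrite geq_max => /andP[k1 k2].
  have gk : 0 <= A * rho ^+ k by rewrite mulr_ge0// exprn_ge0// ltW.
  apply: le_trans (hN k k1); rewrite /geometric/= (ger0_norm gk).
  by rewrite distrC ltW// ltNge; apply/negP; exact: h.
have mEq : measurable [set w | Zt t w = Z t w].
  rewrite (_ : [set w | _] = (Zt t \- Z t) @^-1` [set 0]).
    by rewrite -[X in measurable X]setTI; apply: measurable_funB => //;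
      [exact: mZt|exact: mZ].
  by apply/seteqP; split=> w /= => [->|/eqP]; [rewrite subrr|rewrite subr_eq0 => /eqP].
have P0 : P (~` [set w | Zt t w = Z t w]) = 0%E.
  apply/eqP; rewrite eq_le measure_ge0 andbT.
  apply: (@le_trans _ _ (P (lim_sup_set bad `|` lim_sup_set E))).
    by apply: le_measure => //; rewrite inE; [exact: measurableC|];
      apply: measurableU; exact: measurable_lim_sup_set.
  apply: (@le_trans _ _ (P (lim_sup_set bad) + P (lim_sup_set E))%E).
    by apply: measureU2; exact: measurable_lim_sup_set.
  by rewrite PG PE adde0.
by rewrite -[X in P X]setCK probability_setC ?P0 ?sube0//; exact: measurableC.
Qed.

(** * Nonnegativity of the eigenvalues *)

(** Keeping integrability together with a real value lets linear combinations of integrals be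
    computed in [R]. *)
Definition has_integral (R : realType) (dX : measure_display) (X : measurableType dX)
    (mu : {measure set X -> \bar R}) (T : set X) (f : X -> R) (v : R) : Prop :=
  mu.-integrable T (EFin \o f) /\ (\int[mu]_(x in T) (f x)%:E = v%:E)%E.

Lemma has_integralD (R : realType) (dX : measure_display) (X : measurableType dX)
    (mu : {measure set X -> \bar R}) (T : set X) (f g : X -> R) (v w : R) :
  measurable T -> has_integral mu T f v -> has_integral mu T g w ->
  has_integral mu T (fun x => f x + g x) (v + w).
Proof.
move=> mT [If Ef] [Ig Eg]; split.
  rewrite (_ : EFin \o _ = (EFin \o f) \+ (EFin \o g))//.
  exact: integrableD.
under eq_integral do rewrite EFinD.
by rewrite integralD//= Ef Eg EFinD.
Qed.

Lemma has_integralZ (R : realType) (dX : measure_display) (X : measurableType dX)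
    (mu : {measure set X -> \bar R}) (T : set X) (f : X -> R) (c v : R) :
  measurable T -> has_integral mu T f v ->
  has_integral mu T (fun x => c * f x) (c * v).
Proof.
move=> mT [If Ef]; split.
  rewrite (_ : EFin \o _ = (fun x => c%:E * (EFin \o f) x)%E)//.
  exact: integrableZl.
under eq_integral do rewrite EFinM.
by rewrite (@integralZl _ _ _ _ _ mT _ If) Ef EFinM.
Qed.

Lemma has_integral_cst (R : realType) (dX : measure_display) (X : measurableType dX)
    (mu : {measure set X -> \bar R}) (T : set X) (c m : R) :
  measurable T -> mu T = m%:E -> has_integral mu T (fun=> c) (c * m).
Proof.
move=> mT mTm; split; last by rewrite integral_cst//= mTm EFinM.
apply: measurable_bounded_integrable => //; first by rewrite mTm ltry.
exact: bounded_cst.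
Qed.

Lemma has_integral_sum (R : realType) (dX : measure_display) (X : measurableType dX)
    (mu : {measure set X -> \bar R}) (T : set X) (m : R) (I : Type) (s : seq I)
    (S : I -> Prop) (f : I -> X -> R) (v : I -> R) :
  measurable T -> mu T = m%:E -> List.Forall S s ->
  (forall i, S i -> has_integral mu T (f i) (v i)) ->
  has_integral mu T (fun x => \sum_(i <- s) f i x) (\sum_(i <- s) v i).
Proof.
move=> mT mTm + fv; elim: s => [_|i s IH].
  rewrite big_nil (_ : (fun _ => _) = (fun=> 0)); last by apply/funext => x; rewrite big_nil.
  by have := has_integral_cst 0 mT mTm; rewrite mul0r.
move=> /List.Forall_cons_iff[Si Ss]; rewrite big_cons (_ : (fun _ => _) =
    (fun x => f i x + \sum_(j <- s) f j x)); last by apply/funext => x; rewrite big_cons.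
by apply: has_integralD => //; [exact: fv|exact: IH].
Qed.

Lemma has_integral_ge0 (R : realType) (dX : measure_display) (X : measurableType dX)
    (mu : {measure set X -> \bar R}) (T : set X) (f : X -> R) (v : R) :
  has_integral mu T f v -> (forall x, T x -> 0 <= f x) -> 0 <= v.
Proof. by move=> [_ E] f0; rewrite -lee_fin -E integral_ge0. Qed.

(* The quadratic form of C at the signed measure with mass [p.1] at [p.2] for p in s. *)
Definition kernel_form (R : realType) (X : Type) (C : X -> X -> R) (s : seq (R * X)) : R :=
  \sum_(p <- s) \sum_(q <- s) p.1 * q.1 * C p.2 q.2.

(* Put a = 1 / mu T and F = lam phi, the image of phi under the integral operator.
   The form Q(nu) + 2 n a <nu, F> + n (n - 1) a^2 lam + n a B is nonnegative at every
   finitely supported signed measure nu, by induction on n: its value at (n + 1, nu)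
   is the mean over x in T of its value at (n, nu + phi(x) delta_x).  Taking nu = 0
   and n large forces lam >= 0. *)
Lemma psd_eigenvalue_ge0 (R : realType) (dX : measure_display)
    (X : measurableType dX) (mu : {measure set X -> \bar R}) (T : set X)
    (C : X -> X -> R) (phi : X -> R) (lam m B : R) :
  measurable T -> 0 < m -> mu T = m%:E ->
  (forall s t, T s -> T t -> C s t = C t s) ->
  (forall s, List.Forall (fun p => T p.2) s -> 0 <= kernel_form C s) ->
  (forall y, T y -> has_integral mu T (fun x => C y x * phi x) (lam * phi y)) ->
  has_integral mu T (fun x => phi x * phi x) 1 ->
  has_integral mu T (fun x => phi x * phi x * C x x) B ->
  0 <= lam.
Proof.
move=> mT m0 mTm Csym Cpsd Ceig phi1 diagB.
pose a := m^-1.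
have a0 : 0 < a by rewrite invr_gt0.
pose L (s : seq (R * X)) : R := \sum_(p <- s) p.1 * phi p.2.
have claim n s : List.Forall (fun p => T p.2) s ->
    0 <= kernel_form C s + 2 * n%:R * a * lam * L s +
      n%:R * (n%:R - 1) * a ^+ 2 * lam + n%:R * a * B.
  elim: n s => [|n IH] s sT.
    by rewrite !(mulr0, mul0r) !addr0; exact: Cpsd.
  set K := kernel_form C s + 2 * n%:R * a * lam * L s + n%:R * (n%:R - 1) * a ^+ 2 * lam
    + n%:R * a * B.
  (* The value of the claim at n with the atom of mass phi x at x added, expanded. Its integral
     times [a] is the claim at n + 1. *)
  pose h x := ((K + 2 * \sum_(p <- s) p.1 * (C p.2 x * phi x)) +
    (2 * n%:R * a * lam) * (phi x * phi x)) + phi x * phi x * C x x.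
  have h_int : has_integral mu T h (K * m + 2 * (\sum_(p <- s) p.1 * (lam * phi p.2)) +
      (2 * n%:R * a * lam) * 1 + B).
    apply: has_integralD => //; apply: has_integralD => //; last exact: has_integralZ.
    apply: has_integralD => //; first exact: has_integral_cst.
    apply: has_integralZ => //; apply: (has_integral_sum mT mTm sT) => p Tp.
    by apply: has_integralZ => //; exact: Ceig.
  have h_ge0 x : T x -> 0 <= h x.
    move=> Tx; have /IH : List.Forall (fun p => T p.2) ((phi x, x) :: s) by constructor.
    have -> : L ((phi x, x) :: s) = phi x * phi x + L s by rewrite /L big_cons.
    have -> : kernel_form C ((phi x, x) :: s) = phi x * phi x * C x x +
        2 * (\sum_(p <- s) p.1 * (C p.2 x * phi x)) + kernel_form C s.
      rewrite /kernel_form big_cons big_cons /=.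
      have -> : \sum_(q <- s) phi x * q.1 * C x q.2 = \sum_(p <- s) p.1 * (C p.2 x * phi x).
        elim: s sT {K h h_int IH} => [|q s IHs]; first by rewrite !big_nil.
        move=> /List.Forall_cons_iff[Tq Ts]; rewrite !big_cons IHs// (Csym x q.2)//.
        by congr (_ + _); ring.
      have -> : \sum_(p <- s) \sum_(q <- (phi x, x) :: s) p.1 * q.1 * C p.2 q.2 =
          \sum_(p <- s) p.1 * (C p.2 x * phi x) +
          \sum_(p <- s) \sum_(q <- s) p.1 * q.1 * C p.2 q.2.
        rewrite -big_split/=; apply: eq_bigr => p _; rewrite big_cons /=.
        by congr (_ + _); ring.
      by ring.
    by move=> /le_trans; apply; rewrite /h /K le_eqVlt; apply/orP; left; apply/eqP; ring.
  have := has_integral_ge0 h_int h_ge0.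
  have -> : \sum_(p <- s) p.1 * (lam * phi p.2) = lam * L s.
    by rewrite /L big_distrr/=; apply: eq_bigr => p _; ring.
  move=> /(mulr_ge0 (ltW a0))/le_trans; apply; rewrite le_eqVlt; apply/orP; left; apply/eqP.
  by rewrite /K -natr1 /a; field; exact: lt0r_neq0.
rewrite leNgt; apply/negP => lam0.
(* At the zero measure the form is n a (B - (n - 1) a (-lam)). With two successors, n - 1 still
   exceeds the quotient, so this is negative. *)
pose n := (Num.truncn (`|B| / (a * - lam))).+2.
have := claim n [::] (List.Forall_nil _).
rewrite /kernel_form /L !big_nil mulr0 !add0r.
have nB : `|B| < (n%:R - 1) * (a * - lam).
  rewrite -ltr_pdivrMr ?mulr_gt0 ?oppr_gt0// /n -natr1 addrK; exact: truncnS_gt.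
have n0 : 0 < n%:R :> R by rewrite ltr0n.
have -> : n%:R * (n%:R - 1) * a ^+ 2 * lam + n%:R * a * B =
    n%:R * a * (B - (n%:R - 1) * (a * - lam)) by ring.
rewrite pmulr_rge0 ?mulr_gt0// subr_ge0 => h.
by move: nB; rewrite ltNge (le_trans h)// ler_norm.
Qed.

(** * Borel measurability and integrals on compact sets *)

(** The norm of 'rV[R]_d is the maximum norm. The crude factor d + 1 in place of sqrt d is positive
    also for d = 0, so one can divide by it. *)
Lemma eucl_norm_le (R : realType) (d : nat) (v : 'rV[R]_d) :
  eucl_norm v <= d.+1%:R * `|v|.
Proof.
rewrite -[leRHS]ger0_norm ?mulr_ge0// -sqrtr_sqr ler_sqrt ?sqr_ge0//.
apply: (@le_trans _ _ (\sum_(i < d) `|v| ^+ 2)).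
  by apply: ler_sum => i _; rewrite -real_normK ?num_real// lerXn2r ?nnegrE ?coord_le_norm.
rewrite sumr_const card_ord -[leLHS]mulr_natl exprMn ler_wpM2r ?sqr_ge0//.
by rewrite -natrX ler_nat -mulnn (leq_trans (leqnSn d))// leq_pmull.
Qed.

Lemma open_measurable_Rd (R : realType) (d : nat) (A : set 'rV[R]_d) :
  open A -> measurable (A : set (Rd R d)).
Proof. by move=> oA; apply: sub_sigma_algebra. Qed.

Lemma closed_measurable_Rd (R : realType) (d : nat) (A : set 'rV[R]_d) :
  closed A -> measurable (A : set (Rd R d)).
Proof.
move=> cA; rewrite -[A]setCK; apply: measurableC; apply: open_measurable_Rd.
exact: closed_openC.
Qed.

Lemma compact_measurable_Rd (R : realType) (d : nat) (T : set 'rV[R]_d) :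
  compact T -> measurable (T : set (Rd R d)).
Proof.
move=> cT; apply: closed_measurable_Rd; apply: compact_closed cT.
exact: norm_hausdorff.
Qed.

Lemma within_continuous_measurable_Rd (R : realType) (d : nat)
    (T : set 'rV[R]_d) (f : 'rV[R]_d -> R) :
  measurable (T : set (Rd R d)) -> {within T, continuous f} ->
  measurable_fun (T : set (Rd R d)) (f : Rd R d -> R).
Proof.
move=> mT /continuousP cf; apply: (measurability _ (RGenOpens.measurableE R)).
move=> _ [_ [a [b ->] <-]].
have /open_subspaceP[V oV VE] := cf _ (@interval_open R (BRight a) (BLeft b) isT isT).
rewrite setIC -VE; apply: measurableI => //; exact: open_measurable_Rd.
Qed.

Lemma compact_finite_lebesgue (R : realType) (d : nat)
    (mu : {measure set (Rd R d) -> \bar R}) (T : set 'rV[R]_d) :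
  is_lebesgue_measure mu -> compact T -> (mu T < +oo)%E.
Proof.
move=> Hmu cT; have [N N0 TN] := compact_bounded_coord cT.
(* The strict coordinate bound puts T inside the half-open box [-N, N)^d, whose measure is known. *)
pose a : 'rV[R]_d := const_mx (- N%:R); pose b : 'rV[R]_d := const_mx N%:R.
pose box := [set x : Rd R d | forall i, a ord0 i <= (x : 'rV[R]_d) ord0 i < b ord0 i].
have mbox : measurable box.
  have -> : box = \bigcap_(i in [set: 'I_d])
      [set x : Rd R d | a ord0 i <= (x : 'rV[R]_d) ord0 i < b ord0 i].
    by apply/seteqP; split=> x /= h; [move=> i _; exact: h|move=> i; exact: h].
  apply: fin_bigcap_measurable => // i _.
  have -> : [set x : Rd R d | a ord0 i <= (x : 'rV[R]_d) ord0 i < b ord0 i] =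
     ([set x : 'rV[R]_d | a ord0 i <= x ord0 i] `&` [set x | x ord0 i < b ord0 i]).
    by apply/seteqP; split=> x /= /andP.
  have cont : continuous (fun x : 'rV[R]_d => x ord0 i).
    by move=> x; exact: coord_continuous.
  apply: measurableI.
    apply: closed_measurable_Rd.
    exact: ((continuous_closedP _).1 cont _ (@closed_ge R (a ord0 i))).
  apply: open_measurable_Rd.
  exact: ((continuousP _).1 cont _ (@open_lt R (b ord0 i))).
apply: (@le_lt_trans _ _ (mu box)).
  apply: le_measure; rewrite ?inE//; first exact: compact_measurable_Rd.
  move=> t Tt i; rewrite !mxE; have := TN t i Tt; rewrite ltr_norml => /andP[/ltW -> ->//].
by rewrite Hmu ?ltry// => i; rewrite !mxE lerNl; apply: (@le_trans _ _ 0); rewrite ?oppr_le0.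
Qed.

Lemma continuous_integrable_Rd (R : realType) (d : nat)
    (mu : {measure set (Rd R d) -> \bar R}) (T : set 'rV[R]_d) (f : 'rV[R]_d -> R) :
  is_lebesgue_measure mu -> compact T -> {within T, continuous f} ->
  mu.-integrable (T : set (Rd R d)) (EFin \o (f : Rd R d -> R)).
Proof.
move=> Hmu cT cf; have mT := compact_measurable_Rd cT.
apply: measurable_bounded_integrable => //.
- exact: compact_finite_lebesgue.
- exact: within_continuous_measurable_Rd.
have [M [Mr HM]] := compact_bounded (continuous_compact cf cT).
exists M; split=> // x Mx y Ty; apply: (HM x Mx); by exists y.
Qed.

Lemma holder_within_continuous (R : realType) (d : nat) (T : set 'rV[R]_d)
    (f : 'rV[R]_d -> R) (M alpha : R) :
  0 < M -> 0 < alpha ->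
  (forall x y, T x -> T y -> `|f x - f y| <= M * powR (eucl_norm (x - y)) alpha) ->
  {within T, continuous f}.
Proof.
move=> M0 a0 H; apply/subspace_continuousP => x Tx; apply/cvgrPdist_le => e e0.
have eM : 0 < e / M by rewrite divr_gt0.
rewrite near_withinE; apply/(@nbhs_normP _ 'rV[R]_d).
(* Solves M r^alpha = e for the Euclidean distance r, then passes to the maximum norm. *)
exists (powR (e / M) alpha^-1 / d.+1%:R); first by rewrite /= divr_gt0// powR_gt0.
move=> y /= xy Ty; apply: le_trans (H _ _ Tx Ty) _.
rewrite mulrC -ler_pdivlMr//.
have -> : e / M = powR (powR (e / M) alpha^-1) alpha.
  by rewrite -powRrM mulVf ?lt0r_neq0// powRr1// ltW.
apply: ge0_ler_powR; rewrite ?nnegrE ?sqrtr_ge0 ?powR_ge0//; first exact: ltW.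
apply: le_trans (eucl_norm_le _) _.
by rewrite mulrC -ler_pdivlMr//; exact: ltW.
Qed.

(** * Eigenvalues and increments of the Mercer expansion *)

Lemma psd_kernel_form_ge0 (R : realType) (d : nat) (T : set 'rV[R]_d)
    (C : 'rV[R]_d -> 'rV[R]_d -> R) (s : seq (R * 'rV[R]_d)) :
  psd_kernel T C -> List.Forall (fun p => T p.2) s -> 0 <= kernel_form C s.
Proof.
move=> psd sT; rewrite /kernel_form big_tnth.
under eq_bigr do rewrite big_tnth.
apply: (psd (size s) (fun i => (tnth (in_tuple s) i).2) (fun i => (tnth (in_tuple s) i).1)).
move=> i; rewrite (tnth_nth (0, 0)) /=.
move: (val i) (ltn_ord i) => {i}; elim: s sT => [//|p s IH] /List.Forall_cons_iff[Tp Ts] [|j]//=.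
exact: (IH Ts j).
Qed.

Lemma mercer_eigenvalue_ge0 (R : realType) (d : nat)
    (mu : {measure set (Rd R d) -> \bar R}) (T : set 'rV[R]_d)
    (C : 'rV[R]_d -> 'rV[R]_d -> R) (phi : 'rV[R]_d -> R) (lam M alpha : R) :
  is_lebesgue_measure mu -> compact T -> (0 < mu T)%E ->
  symmetric_kernel T C -> psd_kernel T C -> 0 < M -> 0 < alpha ->
  (forall t1 t2 s, T t1 -> T t2 -> T s ->
     `|C t1 s - C t2 s| <= M * powR (eucl_norm (t1 - t2)) alpha) ->
  {within T, continuous phi} ->
  (\int[mu]_(x in T) (phi x * phi x)%:E = 1)%E ->
  (forall s, T s -> (\int[mu]_(t in T) (C s t * phi t)%:E)%E = (lam * phi s)%:E) ->
  0 <= lam.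
Proof.
move=> Hmu cT mT0 Csym Cpsd M0 a0 hol cphi phi1 eig.
have mT := compact_measurable_Rd cT.
have mTfin : mu T \is a fin_num.
  by rewrite ge0_fin_numE// compact_finite_lebesgue.
have int f : {within T, continuous f} ->
    mu.-integrable (T : set (Rd R d)) (EFin \o (f : Rd R d -> R)).
  exact: continuous_integrable_Rd.
have cM (f g : 'rV[R]_d -> R) : {within T, continuous f} -> {within T, continuous g} ->
    {within T, continuous (fun x => f x * g x)}.
  by move=> cf cg x; apply: continuousM; [exact: cf|exact: cg].
have cC y : T y -> {within T, continuous (C y)}.
  move=> Ty; apply: (holder_within_continuous M0 a0) => x z Tx Tz.
  by rewrite (Csym y x)// (Csym y z)//; exact: hol.
(* On the diagonal one argument is moved at a time, which doubles the Hoelder constant. *)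
have cD : {within T, continuous (fun x => C x x)}.
  apply: (@holder_within_continuous _ _ _ _ (M + M) alpha) => //; first exact: addr_gt0.
  move=> x z Tx Tz.
  rewrite (_ : _ - _ = (C x x - C z x) + (C x z - C z z)); last by rewrite (Csym z x)//; ring.
  by rewrite mulrDl; apply: le_trans (ler_normD _ _) _; apply: lerD; exact: hol.
have iphi := int _ (cM _ _ cphi cphi).
have idiag := int _ (cM _ _ (cM _ _ cphi cphi) cD).
apply: (@psd_eigenvalue_ge0 R _ (Rd R d) mu T C phi lam (fine (mu T))
  (fine (\int[mu]_(x in T) (phi x * phi x * C x x)%:E)%E)) => //.
- by rewrite fine_gt0// mT0 -ge0_fin_numE.
- by rewrite fineK.
- by move=> s; exact: psd_kernel_form_ge0.
- move=> y Ty; split; last exact: eig.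
  by apply: int; apply: cM => //; exact: cC.
by rewrite /has_integral fineK//; exact: integrable_fin_num.
Qed.

(** Since the eigenvalues are nonnegative, the partial sums increase to (C s s - C t s) - (C s t - C
    t t), and each bracket is a Hoelder difference in the first argument. *)
Lemma mercer_increment (R : realType) (d : nat) (T : set 'rV[R]_d)
    (C : 'rV[R]_d -> 'rV[R]_d -> R) (lambda : nat -> R) (phi : nat -> 'rV[R]_d -> R)
    (M alpha : R) (n : nat) (s t : 'rV[R]_d) :
  (forall t1 t2 s, T t1 -> T t2 -> T s ->
     `|C t1 s - C t2 s| <= M * powR (eucl_norm (t1 - t2)) alpha) ->
  (forall s t, T s -> T t ->
     (fun n => \sum_(j < n) lambda j * phi j s * phi j t) @ \oo --> C s t) ->
  (forall j, 0 <= lambda j) -> T s -> T t ->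
  \sum_(j < n) lambda j * (phi j s - phi j t) ^+ 2 <=
    2 * M * powR (eucl_norm (s - t)) alpha.
Proof.
move=> hol mercer l0 Ts Tt.
pose u n := \sum_(j < n) lambda j * (phi j s - phi j t) ^+ 2.
have cu : u @ \oo --> (C s s - C t s) - (C s t - C t t).
  have -> : u = (fun n => (\sum_(j < n) lambda j * phi j s * phi j s -
      \sum_(j < n) lambda j * phi j t * phi j s) -
      (\sum_(j < n) lambda j * phi j s * phi j t - \sum_(j < n) lambda j * phi j t * phi j t)).
    by apply/funext => m; rewrite /u -!sumrB; apply: eq_bigr => j _; ring.
  by apply: cvgB; apply: cvgB; exact: mercer.
have ndu : nondecreasing_seq u.
  apply/nondecreasing_seqP => m; rewrite /u big_ord_recr/= lerDl.
  by rewrite mulr_ge0// sqr_ge0.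
apply: le_trans (nondecreasing_cvgn_le ndu _ n) _; first by apply/cvg_ex; eexists; exact: cu.
rewrite (cvg_lim (@Rhausdorff R) cu).
apply: le_trans (ler_norm _) _; apply: le_trans (ler_normB _ _) _.
by rewrite (_ : 2 * M = M + M) ?mulrDl; [apply: lerD; exact: hol|ring].
Qed.

(** * The modification *)

(** Each of the k + 1 terms of 1 + rho + ... + rho^k is at least rho^k, and the sum is below 1 / (1
    - rho). This absorbs the linear growth in k of the tail threshold. *)
Lemma linear_geometric_bounded (R : realType) (rho : R) (k : nat) :
  0 < rho < 1 -> k.+1%:R * rho ^+ k <= (1 - rho)^-1.
Proof.
move=> /andP[r0 r1]; have h : 0 < 1 - rho by rewrite subr_gt0.
rewrite -[leRHS]mul1r ler_pdivlMr//.
suff : k.+1%:R * rho ^+ k * (1 - rho) <= 1 - rho ^+ k.+1.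
  by move=> /le_trans; apply; rewrite gerBl exprn_ge0// ltW.
elim: k => [|k IH]; first by rewrite expr0 expr1 mulr1 mul1r.
have p1 : rho ^+ k.+1 <= 1 by rewrite exprn_ile1// ltW.
have p0 : 0 <= rho ^+ k by rewrite exprn_ge0// ltW.
move: IH p1; rewrite -[k.+2%:R]natr1 !exprS; set c := k.+1%:R; set y := rho ^+ k => IH p1.
have : rho * (c * y * (1 - rho)) <= rho * (1 - rho * y) by rewrite ler_wpM2l// ltW.
have : rho * y * (1 - rho) <= 1 * (1 - rho) by rewrite ler_wpM2r// ltW.
lra.
Qed.

(** The truncated increment is a Laplace sum with coefficients sqrt(lambda_j) (phi_j p - phi_j q);
    its tail passes to the L^2 limit at the cost of the factor 2. *)
Lemma laplace_process_increment_tail (R : realType) (d : nat) (T : set 'rV[R]_d)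
    (lambda : nat -> R) (phi : nat -> 'rV[R]_d -> R)
    (dO : measure_display) (Omega : measurableType dO) (P : probability Omega R)
    (Zj : nat -> Omega -> R) (Z : 'rV[R]_d -> Omega -> R) (p q : 'rV[R]_d) (sigma x : R) :
  (forall j, laplace_distributed P (Zj j)) -> mutually_independent P Zj ->
  (forall t, T t -> measurable_fun setT (Z t)) ->
  (forall t, T t ->
     (fun n => (\int[P]_w
        ((Z t w - \sum_(j < n) Num.sqrt (lambda j) * Zj j w * phi j t) ^+ 2)%:E)%E)
       @ \oo --> 0%E) ->
  (forall j, 0 <= lambda j) -> T p -> T q -> 0 < sigma -> 0 < x ->
  (forall n, \sum_(j < n) lambda j * (phi j p - phi j q) ^+ 2 <= sigma ^+ 2) ->
  (P [set w | (2 * (x * sigma) <= `|Z p w - Z q w|)%R] <= (2 * expR (1 - x))%:E)%E.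
Proof.
move=> lapZ indZ mZ serZ l0 Tp Tq s0 x0 var.
have mS t n : measurable_fun setT
    (fun w => \sum_(j < n) Num.sqrt (lambda j) * Zj j w * phi j t).
  apply: measurable_sum => j _; apply: measurable_funM => //.
  by apply: measurable_funM => //; case: (lapZ j).
apply: (tail_of_L2_limit (mZ p Tp) (mZ q Tq) (mS p) (mS q) (serZ p Tp) (serZ q Tq)).
  exact: mulr_gt0.
move=> n.
have E w : \sum_(j < n) Num.sqrt (lambda j) * Zj j w * phi j p -
    \sum_(j < n) Num.sqrt (lambda j) * Zj j w * phi j q =
    \sum_(j < n) (Num.sqrt (lambda j) * (phi j p - phi j q)) * Zj j w.
  by rewrite -sumrB; apply: eq_bigr => j _; ring.
under eq_set do rewrite E.
apply: (@laplace_sum_tail _ _ _ P Zj (fun j => Num.sqrt (lambda j) * (phi j p - phi j q))) => //.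
apply: le_trans (var n); apply: ler_sum => j _.
by rewrite exprMn sqr_sqrtr.
Qed.

Unset Implicit Arguments.

Theorem theorem5 (R : realType) (d : nat)
  (mu : {measure set (Rd R d) -> \bar R}) (Hmu : is_lebesgue_measure mu)
  (T : set 'rV[R]_d) (HTc : compact T) (HTpos : (0 < mu T)%E)
  (C : 'rV[R]_d -> 'rV[R]_d -> R)
  (HCsym : symmetric_kernel T C) (HCpsd : psd_kernel T C)
  (HCholder : exists (MC alpha : R), 0 < MC /\ 0 < alpha <= 1 /\
     forall t1 t2 s, T t1 -> T t2 -> T s ->
       `|C t1 s - C t2 s| <= MC * powR (eucl_norm (t1 - t2)) alpha)
  (lambda : nat -> R) (phi : nat -> 'rV[R]_d -> R)
  (Hphi_cont : forall j, {within T, continuous (phi j)})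
  (Hphi_orth : forall i j,
     (\int[mu]_(x in T) (phi i x * phi j x)%:E)%E = (if i == j then 1 else 0)%:E)
  (Heigen : forall j s, T s ->
     (\int[mu]_(t in T) (C s t * phi j t)%:E)%E = (lambda j * phi j s)%:E)
  (Hmercer : forall s t, T s -> T t ->
     (fun n => \sum_(j < n) lambda j * phi j s * phi j t) @ \oo --> C s t)
  (dO : measure_display) (Omega : measurableType dO) (P : probability Omega R)
  (Zj : nat -> Omega -> R)
  (HZlap : forall j, laplace_distributed P (Zj j))
  (HZind : mutually_independent P Zj)
  (Z : 'rV[R]_d -> Omega -> R)
  (HZmeas : forall t, T t -> measurable_fun setT (Z t))
  (HZseries : forall t, T t ->
     (fun n => (\int[P]_w
        ((Z t w - \sum_(j < n) Num.sqrt (lambda j) * Zj j w * phi j t) ^+ 2)%:E)%E)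
       @ \oo --> 0%E) :
  exists Zt : 'rV[R]_d -> Omega -> R,
    (forall t, T t -> measurable_fun setT (Zt t)) /\
    (forall w, {within T, continuous (fun t => Zt t w)}) /\
    (forall t, T t -> P [set w | Zt t w = Z t w] = 1%E).
Proof.
have [MC [alpha [M0 [/andP[a0 a1] hol]]]] := HCholder.
have l0 j : 0 <= lambda j.
  apply: (mercer_eigenvalue_ge0 Hmu HTc HTpos HCsym HCpsd M0 a0 hol (Hphi_cont j) _ (Heigen j)).
  by rewrite Hphi_orth eqxx.
have h0 : 0 < 2^-1 :> R by rewrite invr_gt0.
have h1 : 2^-1 < 1 :> R by rewrite invf_lt1// ltr1n.
(* The increment variance at level k is of order 2^(-k alpha) = rho^(4k), so sigma is of order
   rho^(2k). One factor rho^k is the chaining rate, the other absorbs k + 1. *)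
pose rho := powR 2^-1 (alpha / 4) : R.
have rho4 : rho ^+ 4 = powR 2^-1 alpha.
  by rewrite -powR_mulrn ?powR_ge0// -powRrM divfK// pnatr_eq0.
have rho0 : 0 < rho by rewrite powR_gt0.
have rho1 : rho < 1.
  rewrite -(@expr_lt1 _ 4)//; last exact: ltW.
  have <- : powR (1 : R) alpha = 1 by rewrite powR1.
  by rewrite rho4 gt0_ltr_powR// ?nnegrE// ltW.
(* A distance 3 * 2^-k in the maximum norm is at most D 2^-k in the Euclidean norm. *)
pose D : R := 3 * d.+1%:R.
have D0 : 0 < D by rewrite mulr_gt0// ltr0n.
pose c0 := Num.sqrt (2 * MC * powR D alpha).
have c0_gt0 : 0 < c0 by rewrite sqrtr_gt0 !mulr_gt0// powR_gt0.
(* Chosen so that exp(-k L) is the tail rate (2 * 4^d)^-k required for the chaining. *)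
pose L := ln (2 * 4 ^+ d) : R.
have q0 : 0 < 2 * 4 ^+ d :> R by rewrite mulr_gt0// exprn_gt0.
have L0 : 0 < L.
  by rewrite ln_gt0// (@lt_le_trans _ _ 2)// ?ltr1n// ler_peMr// exprn_ege1// ler1n.
pose A := 2 * L * c0 * (1 - rho)^-1.
have A0 : 0 <= A by rewrite !mulr_ge0 ?invr_ge0 ?subr_ge0// ltW.
apply: (@chaining_modification R d T dO Omega P Z A rho (2 * expR (1 - L))) => //.
  by rewrite rho0.
move=> k p q Tp Tq pq.
pose sigma := c0 * (rho ^+ 2) ^+ k.
(* With k + 1 instead of k, x is positive at level 0; the extra L goes into the constant 2 exp(1 -
   L). *)
pose x := k.+1%:R * L.
have s0 : 0 < sigma by rewrite mulr_gt0// !exprn_gt0.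
have x0 : 0 < x by rewrite mulr_gt0// ltr0n.
have var n : \sum_(j < n) lambda j * (phi j p - phi j q) ^+ 2 <= sigma ^+ 2.
  apply: le_trans (mercer_increment n hol Hmercer l0 Tp Tq) _.
  rewrite /sigma exprMn sqr_sqrtr; last by rewrite !mulr_ge0 ?powR_ge0// ltW.
  rewrite -mulrA -[leRHS]mulrA -mulrA !ler_wpM2l//; first exact: ltW.
  have -> : ((rho ^+ 2) ^+ k) ^+ 2 = powR (2^-1 ^+ k) alpha.
    rewrite -!exprM (_ : 2 * (k * 2) = 4 * k)%N; last by ring.
    rewrite exprM rho4 -powR_mulrn ?powR_ge0// -powR_mulrn; last exact: ltW.
    by rewrite -!powRrM mulrC.
  have k_ge0 : 0 <= 2^-1 ^+ k :> R by rewrite exprn_ge0// ltW.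
  rewrite -(powRM _ (ltW D0) k_ge0).
  apply: ge0_ler_powR; rewrite ?nnegrE ?sqrtr_ge0// ?mulr_ge0// ?(ltW D0)//; first exact: ltW.
  apply: le_trans (eucl_norm_le _) _.
  by rewrite /D (mulrC 3) -mulrA ler_wpM2l.
apply: (@le_trans _ _ (2 * expR (1 - x))%:E); last first.
  rewrite lee_fin -mulrA ler_wpM2l//.
  rewrite (_ : 1 - x = (1 - L) - k%:R * L); last by rewrite /x -natr1; ring.
  by rewrite expRB expRM_natl lnK ?posrE.
apply: le_trans (laplace_process_increment_tail HZlap HZind HZmeas HZseries l0 Tp Tq s0 x0 var).
apply: le_measure; rewrite ?inE.
- by apply: measurable_norm_ge; apply: measurable_funB; exact: HZmeas.
- by apply: measurable_norm_ge; apply: measurable_funB; exact: HZmeas.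
(* It remains to see 2 x sigma <= A rho^k, that is, (k + 1) rho^k <= 1 / (1 - rho) multiplied by 2 L
   c0 rho^k. *)
move=> w /=; apply: le_trans.
rewrite /A /x /sigma -exprM mul2n -addnn exprD.
have := @linear_geometric_bounded R rho k; rewrite rho0 rho1 => /(_ isT) lin.
have pk : 0 <= 2 * L * c0 * rho ^+ k by rewrite !mulr_ge0 ?exprn_ge0 ?ltW.
have := ler_wpM2l pk lin.
by move=> h; apply: le_trans (le_trans h _); rewrite le_eqVlt; apply/orP; left; apply/eqP; ring.
Qed.
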